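(* Let $f:[0,\infty)\to\mathbb{R}$ be a function that is differentiable on $(0,\infty)$, let $0<a<b$, and suppose $f'\in L[a,b]$. Let $s\in(0,1]$ be fixed and let $q>1$ and $p$ satisfy $\frac1p+\frac1q=1$. If $|f'|^q$ is $s$-convex in the second sense on $[a,b]$, then $$\left|\frac{1}{b-a}\int_a^b f(x)\,dx-\frac12\left(\frac{b f(a)-a f(b)}{b-a}+f\left(\frac{a+b}{2}\right)\right)\right|$$ $$\le \frac{L_p(a,b)}{4\left(2^s(s+1)\right)^{1/q}}\left\{\left(|f'(b)|^q+\left(2^{s+1}-1\right)|f'(a)|^q\right)^{1/q}+\left(|f'(a)|^q+\left(2^{s+1}-1\right)|f'(b)|^q\right)^{1/q}\right\}.$$
   Context: For $s\in(0,1]$, a function $\varphi$ with values in $[0,\infty)$ is $s$-convex in the second sense on an interval $I\subseteq[0,\infty)$ if $\varphi(tx+(1-t)y)\le t^s\varphi(x)+(1-t)^s\varphi(y)$ for all $x,y\in I$ and all $t\in[0,1]$. $L[a,b]$ denotes the (Lebesgue) integrable functions on $[a,b]$. For $0<u<v$ and real $p\neq -1,0$, $L_p(u,v)=\left(\frac{v^{p+1}-u^{p+1}}{(p+1)(v-u)}\right)^{1/p}$ is the generalized logarithmic mean. *)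

(* Defs.v *)
From mathcomp Require Import all_boot all_order all_algebra.
From mathcomp Require Import all_classical all_reals all_analysis.

Set Implicit Arguments.
Unset Strict Implicit.
Unset Printing Implicit Defensive.

Import Order.TTheory GRing.Theory Num.Theory.
Import numFieldNormedType.Exports.

Local Open Scope classical_set_scope.
Local Open Scope ring_scope.

(* s-convexity in the second sense, meant for 0 < s <= 1; the endpoint values
   t = 0, 1 are harmless since powR has 0 `^ s = 0 for s != 0. The first two
   clauses record that phi maps an interval of [0, +oo[ into [0, +oo[. *)
Definition s_convex2 (R : realType) (s : R) (I : interval R) (phi : R -> R)
    : Prop :=
  [/\ [set` I] `<=` [set x | 0 <= x],
      (forall x, x \in I -> 0 <= phi x) &
      forall x y t : R, x \in I -> y \in I -> 0 <= t -> t <= 1 ->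
        phi (t * x + (1 - t) * y) <= t `^ s * phi x + (1 - t) `^ s * phi y].

(* Meaningful for 0 < u < v and p different from -1 and 0. *)
Definition gen_log_mean (R : realType) (p u v : R) : R :=
  ((v `^ (p + 1) - u `^ (p + 1)) / ((p + 1) * (v - u))) `^ p^-1.

(* Main.v *)
Require Import Defs.
From mathcomp Require Import all_boot all_order all_algebra.
From mathcomp Require Import all_classical all_reals all_analysis.
From mathcomp Require Import ring lra.

(** Let [m] be the midpoint of [[a, b]] and [Phi] the primitive of [f] that
    vanishes at [a]. On each of the halves [[a, m]] and [[m, b]] take the affine
    function [y] of slope [-2] which decreases from [b] to [a]. The function
    [y * f + 2 * Phi] then has derivative [y * f'], and the sum of its two
    increments is

      [2 * Phi b - (b * f a - a * f b) - (b - a) * f m],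

    that is, [2 * (b - a)] times the quantity to be estimated. What remains is
    to bound the increment of a function with derivative [y * f'] on each half.

    Hoelder's inequality bounds it by the [p]-norm of [y] times the [q]-norm of
    [f']. The first is a power of the half-length times the logarithmic mean of
    [a] and [b]. For the second, s-convexity bounds [`|f'| `^ q] by
    [((b - x) / (b - a)) `^ s * `|f' a| `^ q
     + ((x - a) / (b - a)) `^ s * `|f' b| `^ q],
    whose integrals over the two halves are, up to a common factor, the two sums
    raised to the power [q^-1] in the final bound
    ([sconvex_bound_primitive_half_increments]).

    Since the derivative [f'] need not be continuous, its integral is avoided:
    Hoelder's inequality is proved for increments ([increment_le_hoelder]).
    Young's inequality bounds [y * `|f'|] pointwise by the derivative of an
    explicit function, and the mean value theorem passes from the derivatives
    to the increments. Only the continuous function [f] gets integrated, and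
    there the first fundamental theorem of calculus applies. *)

Set Implicit Arguments.
Unset Strict Implicit.
Unset Printing Implicit Defensive.

Import Order.TTheory GRing.Theory Num.Theory.
Import numFieldNormedType.Exports.

Local Open Scope classical_set_scope.
Local Open Scope ring_scope.

(** * Continuity and derivatives of real powers *)

(** The absolute value makes the power continuous across [0]: as a function of
    a signed base, [x `^ r] jumps there, being [1] for negative [x]. *)
Lemma continuous_powR_norm (R : realType) (r : R) : 0 < r ->
  continuous (fun x : R => `|x| `^ r).
Proof.
move=> r0 x; have [->|x0] := eqVneq x 0.
  rewrite /continuous_at normr0 powR0 ?gt_eqF//.
  apply/cvgrPdist_lt => e e0.
  move/cvgrPdist_lt: (powR_cvg0 r0) => /(_ _ e0).
  rewrite near_withinE => /nbhs_ballP[d /= d0 H].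
  apply/nbhs_ballP; exists d => //= y yd.
  have [->|y0] := eqVneq y 0; first by rewrite normr0 powR0 ?gt_eqF// subrr normr0.
  apply: H; last by rewrite normr_gt0.
  by move: yd; rewrite /ball/= !sub0r !normrN normr_id.
have cn : {for x, continuous (fun z : R => `|z|)} by exact: norm_continuous.
have cp : {for `|x|, continuous (@powR R ^~ r)}.
  apply/differentiable_continuous/derivable1_diffP/derivable_powR.
  by rewrite in_itv/= andbT normr_gt0.
have := continuous_comp cn cp.
by [].
Qed.

Lemma within_continuous_powR (R : realType) (g : R -> R) (A : set R) (r : R) :
  0 < r -> continuous g -> (forall x, A x -> 0 <= g x) ->
  {within A, continuous (fun x => g x `^ r)}.
Proof.
move=> r0 cg g0.
have cgr : {within A, continuous (fun x => `|g x| `^ r)}.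
  apply: continuous_subspaceT => x.
  apply: (@continuous_comp R R R g (fun y : R => `|y| `^ r) x (cg x)).
  exact: continuous_powR_norm.
apply: (subspace_eq_continuous _ cgr) => x /set_mem /g0 gx /=.
by rewrite /from_subspace ger0_norm.
Qed.

(** The exponent is written [r + 1] because primitives are what is needed: up
    to a constant, this says which function has derivative [g `^ r * dg]. *)
Lemma is_derive_comp_powR (R : realType) (g : R -> R) (x dg r : R) :
  is_derive x 1 g dg -> 0 < g x ->
  is_derive x 1 (fun x => g x `^ (r + 1)) ((r + 1) * g x `^ r * dg).
Proof.
move=> hg gx; have := @is_derive1_powR R (r + 1) (g x) gx.
rewrite addrK => h.
have := is_derive1_comp h hg.
by [].
Qed.

(** * A Hoelder inequality for increments *)

(** Both [G - F] and [G + F] are nondecreasing, by the mean value theorem. This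
    takes the place of integrating [`|dF| <= dG], which would need a fundamental
    theorem of calculus for discontinuous derivatives. *)
Lemma increment_norm_le (R : realType) (F G dF dG : R -> R) (c d : R) : c < d ->
  (forall x, x \in `]c, d[ -> is_derive x 1 F (dF x)) ->
  (forall x, x \in `]c, d[ -> is_derive x 1 G (dG x)) ->
  {within `[c, d], continuous F} -> {within `[c, d], continuous G} ->
  (forall x, x \in `]c, d[ -> `|dF x| <= dG x) ->
  `|F d - F c| <= G d - G c.
Proof.
move=> cd hF hG cF cG le.
have dc : 0 <= d - c by rewrite subr_ge0 ltW.
have cB : {within `[c, d], continuous (G \- F)}.
  by move=> x; apply: continuousB; [exact: cG|exact: cF].
have cD : {within `[c, d], continuous (G \+ F)}.
  by move=> x; apply: continuousD; [exact: cG|exact: cF].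
have hB x : x \in `]c, d[ -> is_derive x 1 (G \- F) (dG x - dF x).
  by move=> xcd; apply: is_deriveB; [exact: hG|exact: hF].
have hD x : x \in `]c, d[ -> is_derive x 1 (G \+ F) (dG x + dF x).
  by move=> xcd; apply: is_deriveD; [exact: hG|exact: hF].
have [x xcd eB] := MVT cd hB cB.
have [y ycd eD] := MVT cd hD cD.
have := le x xcd; have := le y ycd; rewrite !ler_norml => /andP[y1 y2] /andP[x1 x2].
have : 0 <= (dG x - dF x) * (d - c) by rewrite mulr_ge0// subr_ge0.
have : 0 <= (dG y + dF y) * (d - c) by rewrite mulr_ge0//; lra.
rewrite -eB -eD /=; lra.
Qed.

(** Young's inequality for [k / mu `^ p^-1] and [v / nu `^ q^-1]. When [mu] and
    [nu] are the integrals of [k `^ p] and [v `^ q], integrating the last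
    factor gives [p^-1 + q^-1 = 1], hence Hoelder's inequality. *)
Lemma scaled_young (R : realType) (k v p q mu nu : R) :
  0 < p -> 0 < q -> p^-1 + q^-1 = 1 -> 0 <= k -> 0 <= v -> 0 < mu -> 0 < nu ->
  k * v <= mu `^ p^-1 * nu `^ q^-1 * (k `^ p / (p * mu) + v `^ q / (q * nu)).
Proof.
move=> p0 q0 pq k0 v0 mu0 nu0.
have K0 : 0 < mu `^ p^-1 by rewrite powR_gt0.
have N0 : 0 < nu `^ q^-1 by rewrite powR_gt0.
have scale (a r m : R) : 0 <= a -> 0 < r -> 0 < m ->
    (a / m `^ r^-1) `^ r / r <= a `^ r / (r * m).
  move=> a0 r0 m0; rewrite powRM ?invr_ge0 ?powR_ge0//.
  rewrite -powRN -powRrM mulNr mulVf ?gt_eqF// powR_inv1 ?(ltW m0)//.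
  by rewrite invfM -mulrA [m^-1 * _]mulrC.
have H : k / mu `^ p^-1 * (v / nu `^ q^-1) <=
    k `^ p / (p * mu) + v `^ q / (q * nu).
  apply: le_trans (lerD (scale _ _ _ k0 p0 mu0) (scale _ _ _ v0 q0 nu0)).
  by apply: conjugate_powR => //; rewrite divr_ge0// ltW.
rewrite -(ler_pM2l (mulr_gt0 K0 N0)) in H; apply: le_trans H.
by rewrite le_eqVlt; apply/orP; left; apply/eqP; field; rewrite !gt_eqF.
Qed.

Lemma within_continuousMl (R : realType) (A : set R) (G : R -> R) (c : R) :
  {within A, continuous G} -> {within A, continuous (fun x => c * G x)}.
Proof. by move=> cG x; apply: cvgMl_tmp; exact: cG. Qed.

(** This is Hoelder's inequality with the integrals of [dF], [k `^ p] and [w]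
    expressed as increments of primitives. It follows by comparing [F] with the
    combination of [P] and [W] that the scaled Young inequality dictates, with
    the increments of [P] and [W] as scales; these may vanish, so they are
    first enlarged by [e > 0], and then [e] tends to [0]. *)
Lemma increment_le_hoelder (R : realType) (F P W dF k v w : R -> R) (c d p q : R) :
  0 < p -> 0 < q -> p^-1 + q^-1 = 1 -> c < d ->
  {within `[c, d], continuous F} ->
  {within `[c, d], continuous P} ->
  {within `[c, d], continuous W} ->
  (forall x, x \in `]c, d[ -> is_derive x 1 F (dF x)) ->
  (forall x, x \in `]c, d[ -> is_derive x 1 P (k x `^ p)) ->
  (forall x, x \in `]c, d[ -> is_derive x 1 W (w x)) ->
  (forall x, x \in `]c, d[ ->
    [/\ 0 <= k x, 0 <= v x, `|dF x| <= k x * v x & v x `^ q <= w x]) ->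
  `|F d - F c| <= (P d - P c) `^ p^-1 * (W d - W c) `^ q^-1.
Proof.
move=> p0 q0 pq cd cF cP cW hF hP hW hle.
have incr_ge0 (G dG : R -> R) : {within `[c, d], continuous G} ->
    (forall x, x \in `]c, d[ -> is_derive x 1 G (dG x)) ->
    (forall x, x \in `]c, d[ -> 0 <= dG x) -> 0 <= G d - G c.
  move=> cG hG dG0.
  have c0 : {within `[c, d], continuous (cst 0 : R -> R)}.
    by apply: continuous_subspaceT => x; exact: cst_continuous.
  have h0 (x : R) : x \in `]c, d[ -> is_derive x 1 (cst 0 : R -> R) 0.
    by move=> _; exact: is_derive_cst.
  apply: le_trans (increment_norm_le cd h0 hG c0 cG _) => // x /dG0.
  by rewrite normr0.
have U0 : 0 <= P d - P c by apply: incr_ge0 cP hP _ => x _; exact: powR_ge0.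
have V0 : 0 <= W d - W c.
  by apply: incr_ge0 cW hW _ => x /hle[_ _ _]; apply: le_trans; exact: powR_ge0.
set U := P d - P c in U0 *; set V := W d - W c in V0 *.
have bound e : 0 < e -> `|F d - F c| <= `|U + e| `^ p^-1 * `|V + e| `^ q^-1.
  move=> e0; have Ue : 0 < U + e by lra.
  have Ve : 0 < V + e by lra.
  rewrite (gtr0_norm Ue) (gtr0_norm Ve).
  set K := _ * _.
  have K0 : 0 <= K by rewrite mulr_ge0 ?powR_ge0.
  pose al := K / (p * (U + e)); pose be := K / (q * (V + e)).
  have be0 : 0 <= be by rewrite divr_ge0// mulr_ge0// ltW.
  pose G x := al * P x + be * W x; pose dG x := al * k x `^ p + be * w x.
  have cG : {within `[c, d], continuous G}.
    exact: within_continuousD (within_continuousMl cP) (within_continuousMl cW).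
  have hG x : x \in `]c, d[ -> is_derive x 1 G (dG x).
    by move=> xcd; have h1 := hP x xcd; have h2 := hW x xcd; exact: is_deriveD.
  have le_dG x : x \in `]c, d[ -> `|dF x| <= dG x.
    move=> /hle[k0 v0 dFle vw]; apply: le_trans dFle _.
    apply: le_trans (scaled_young p0 q0 pq k0 v0 Ue Ve) _; rewrite -/K.
    have := ler_wpM2l be0 vw; rewrite /dG /al /be; lra.
  apply: le_trans (increment_norm_le cd hF hG cF cG le_dG) _; rewrite /G.
  have -> : al * P d + be * W d - (al * P c + be * W c) =
      K * (p^-1 * (U / (U + e)) + q^-1 * (V / (V + e))).
    by rewrite /al /be /U /V; field; rewrite !gt_eqF.
  rewrite -[leRHS]mulr1 ler_wpM2l// -[leRHS]pq lerD//.
    by rewrite ler_piMr ?invr_ge0 ?(ltW p0)// ler_pdivrMr//; lra.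
  by rewrite ler_piMr ?invr_ge0 ?(ltW q0)// ler_pdivrMr//; lra.
(* The absolute values make [B] continuous at [0] even when an increment
   vanishes. *)
pose B e := `|U + e| `^ p^-1 * `|V + e| `^ q^-1.
have -> : U `^ p^-1 * V `^ q^-1 = B 0 by rewrite /B !addr0 !ger0_norm.
have cB : B e @[e --> 0^'+] --> B 0.
  apply: cvg_at_right_filter; apply: cvgM.
  - apply: (@continuous_comp _ _ _ (fun e => U + e) (fun x => `|x| `^ p^-1)).
      by apply: cvgD; [exact: cvg_cst|exact: cvg_id].
    by apply: continuous_powR_norm; rewrite invr_gt0.
  - apply: (@continuous_comp _ _ _ (fun e => V + e) (fun x => `|x| `^ q^-1)).
      by apply: cvgD; [exact: cvg_cst|exact: cvg_id].
    by apply: continuous_powR_norm; rewrite invr_gt0.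
apply: (cvgr_to_ge cB); near=> e; apply: bound; near: e.
exact: nbhs_right_gt.
Unshelve. all: by end_near.
Qed.

(** * The two halves of the interval *)

(** A primitive of the bound that s-convexity gives between the values [A] at
    [a] and [B] at [b]. *)
Definition sconvex_bound_primitive (R : realType) (a b s A B x : R) : R :=
  (b - a) / (s + 1) * (B * ((x - a) / (b - a)) `^ (s + 1)
                       - A * ((b - x) / (b - a)) `^ (s + 1)).

Lemma is_derive_sconvex_bound_primitive (R : realType) (a b s A B x : R) :
  0 < s -> x \in `]a, b[ ->
  is_derive x 1 (sconvex_bound_primitive a b s A B)
    (((b - x) / (b - a)) `^ s * A + ((x - a) / (b - a)) `^ s * B).
Proof.
rewrite in_itv/= => s0 /andP[ax xb].
have ba : 0 < b - a by lra.
have h1 : is_derive x 1 (fun y => (y - a) / (b - a)) (b - a)^-1.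
  by apply: is_derive_eq; rewrite /GRing.scale/=; ring.
have h2 : is_derive x 1 (fun y => (b - y) / (b - a)) (- (b - a)^-1).
  by apply: is_derive_eq; rewrite /GRing.scale/=; ring.
have u1 : 0 < (x - a) / (b - a) by rewrite divr_gt0//; lra.
have u2 : 0 < (b - x) / (b - a) by rewrite divr_gt0//; lra.
have H1 := @is_derive_comp_powR _ _ _ _ s h1 u1.
have H2 := @is_derive_comp_powR _ _ _ _ s h2 u2.
rewrite /sconvex_bound_primitive; apply: is_derive_eq.
rewrite /GRing.scale/=; field.
by rewrite !gt_eqF//; lra.
Qed.

Lemma continuous_sconvex_bound_primitive (R : realType) (a b s A B : R) :
  a < b -> 0 < s ->
  {within `[a, b], continuous (sconvex_bound_primitive a b s A B)}.
Proof.
move=> ab s0; have s1 : 0 < s + 1 by lra.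
have ba : 0 < b - a by lra.
apply: within_continuousMl; apply: within_continuousB;
  apply: within_continuousMl; apply: within_continuous_powR => //.
- by move=> x; apply: cvgMr_tmp; apply: cvgB; [exact: cvg_id|exact: cvg_cst].
- by move=> x /=; rewrite in_itv/= => /andP[? ?]; rewrite divr_ge0//; lra.
- by move=> x; apply: cvgMr_tmp; apply: cvgB; [exact: cvg_cst|exact: cvg_id].
- by move=> x /=; rewrite in_itv/= => /andP[? ?]; rewrite divr_ge0//; lra.
Qed.

(** On [[c, d]], which is half as long as [[a, b]], the affine kernel
    [y x = b - 2 * (x - c)] decreases from [b] to [a], and [y * f + 2 * Phi]
    has derivative [y * f'] because the slope of [y] cancels the derivative of
    [2 * Phi]. The integral of [y `^ p] over [[c, d]] is half that of the
    [p]-th power over [[a, b]]; this is where the logarithmic mean comes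
    from. *)
Lemma half_kernel_increment_le (R : realType) (f Phi : R -> R)
    (a b s p q A B c d : R) :
  0 < a -> a < b -> 0 < s -> 0 < p -> 0 < q -> p^-1 + q^-1 = 1 ->
  a <= c -> d <= b -> d = c + (b - a) / 2 ->
  (forall x : R, 0 < x -> derivable f x 1) ->
  {within `[a, b], continuous Phi} ->
  (forall x, x \in `]a, b[ -> is_derive x 1 Phi (f x)) ->
  (forall x, x \in `]a, b[ -> `|derive1 f x| `^ q <=
     ((b - x) / (b - a)) `^ s * A + ((x - a) / (b - a)) `^ s * B) ->
  `|(a * f d + 2 * Phi d) - (b * f c + 2 * Phi c)| <=
    ((b - a) / 2) `^ p^-1 * gen_log_mean p a b *
    (sconvex_bound_primitive a b s A B d
     - sconvex_bound_primitive a b s A B c) `^ q^-1.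
Proof.
move=> a0 ab s0 p0 q0 pq ac db dE hf cPhi hPhi hle.
set W := sconvex_bound_primitive a b s A B.
have cd : c < d by lra.
have p1 : 0 < p + 1 by lra.
have sub : `[c, d] `<=` `[a, b].
  by apply: subset_itvScc; rewrite bnd_simp.
have inab x : x \in `]c, d[ -> x \in `]a, b[.
  by rewrite !in_itv/= => /andP[? ?]; apply/andP; split; lra.
pose y x := b - 2 * (x - c).
have y0 x : x <= d -> 0 < y x by rewrite /y => ?; lra.
have hy (x : R) : is_derive x 1 y (- 2).
  by apply: is_derive_eq; rewrite /GRing.scale/=; ring.
have cy : continuous y.
  by move=> x; apply/differentiable_continuous/derivable1_diffP; case: (hy x).
pose F x := y x * f x + 2 * Phi x.
pose P x := - (2 * (p + 1))^-1 * y x `^ (p + 1).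
have cF : {within `[c, d], continuous F}.
  apply: within_continuousD.
    apply: derivable_within_continuous => x; rewrite in_itv/= => /andP[cx _].
    by apply: derivableM; [case: (hy x)|apply: hf; lra].
  exact/within_continuousMl/(continuous_subspaceW sub).
have cP : {within `[c, d], continuous P}.
  apply: within_continuousMl; apply: within_continuous_powR => // x /=.
  by rewrite in_itv/= => /andP[_ /y0/ltW].
have cW : {within `[c, d], continuous W}.
  exact/(continuous_subspaceW sub)/continuous_sconvex_bound_primitive.
have hF (x : R) : x \in `]c, d[ -> is_derive x 1 F (y x * derive1 f x).
  move=> xcd; have h1 := hPhi _ (inab _ xcd).
  have x0 : 0 < x by move: xcd; rewrite in_itv/= => /andP[? ?]; lra.
  have h2 : is_derive x 1 f (derive1 f x).
    by rewrite derive1E; exact/derivableP/hf.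
  have h3 := hy x.
  by apply: is_derive_eq; rewrite /GRing.scale/=; ring.
have hP (x : R) : x \in `]c, d[ -> is_derive x 1 P (y x `^ p).
  rewrite in_itv/= => /andP[_ /ltW/y0 yx].
  have h := @is_derive_comp_powR _ _ _ _ p (hy x) yx.
  apply: is_derive_eq; rewrite /GRing.scale/=; field.
  by rewrite gt_eqF.
have hW (x : R) : x \in `]c, d[ -> is_derive x 1 W _ :=
  fun xcd => is_derive_sconvex_bound_primitive A B s0 (inab _ xcd).
have -> : a * f d + 2 * Phi d = F d.
  by rewrite /F; congr (_ * _ + _); rewrite /y dE; field.
have -> : b * f c + 2 * Phi c = F c.
  by rewrite /F; congr (_ * _ + _); rewrite /y; ring.
have -> : ((b - a) / 2) `^ p^-1 * gen_log_mean p a b = (P d - P c) `^ p^-1.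
  rewrite /gen_log_mean -powRM; last 2 first.
  - lra.
  - apply: divr_ge0; last by apply: mulr_ge0; lra.
    rewrite subr_ge0; apply: ge0_ler_powR; rewrite ?nnegrE; lra.
  congr (_ `^ _); rewrite /P.
  have -> : y d = a by rewrite /y dE; field.
  have -> : y c = b by rewrite /y; ring.
  by field; rewrite !gt_eqF//; lra.
apply: (increment_le_hoelder p0 q0 pq cd cF cP cW hF hP hW
  (v := fun x => `|derive1 f x|)) => x xcd.
have yx : 0 <= y x by move: xcd; rewrite in_itv/= => /andP[_ /ltW/y0/ltW].
split => //; first by rewrite normrM ger0_norm.
exact: hle (inab _ xcd).
Qed.

(** On each half, the weight of the nearer endpoint is the [s]-th power of a
    variable ranging over [[1/2, 1]], and that of the other endpoint the [s]-th
    power of one ranging over [[0, 1/2]]; the integrals of these powers have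
    the ratio [2 `^ (s + 1) - 1] to [1]. *)
Lemma sconvex_bound_primitive_half_increments (R : realType) (a b s A B : R) :
  a < b -> 0 < s ->
  let W := sconvex_bound_primitive a b s A B in
  let m := (a + b) / 2 in
  let D := 2 `^ s * (s + 1) in
  (W m - W a = (b - a) / 2 * ((B + (2 `^ (s + 1) - 1) * A) / D)) /\
  (W b - W m = (b - a) / 2 * ((A + (2 `^ (s + 1) - 1) * B) / D)).
Proof.
move=> ab s0 W m D.
have ba : b - a != 0 by rewrite gt_eqF// subr_gt0.
have s1 : s + 1 != 0 by rewrite gt_eqF//; lra.
have S0 : 2 `^ s != 0 :> R by rewrite gt_eqF// powR_gt0.
have S1 : 2 `^ (s + 1) = 2 `^ s * 2 :> R.
  by rewrite powRD ?powRr1 ?pnatr_eq0 ?implybT.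
have V : 2^-1 `^ (s + 1) = (2 `^ s * 2)^-1 :> R.
  by rewrite -[2^-1 in LHS]powR_inv1// -powRrM mulN1r powRN S1.
have Wa : W a = (b - a) / (s + 1) * - A.
  by rewrite /W /sconvex_bound_primitive subrr mul0r powR0// divff// powR1; ring.
have Wb : W b = (b - a) / (s + 1) * B.
  by rewrite /W /sconvex_bound_primitive subrr mul0r powR0// divff// powR1; ring.
have Wm : W m = (b - a) / (s + 1) * ((B - A) / (2 `^ s * 2)).
  rewrite /W /sconvex_bound_primitive.
  have -> : (m - a) / (b - a) = 2^-1 by rewrite /m; field.
  have -> : (b - m) / (b - a) = 2^-1 by rewrite /m; field.
  by rewrite V -mulrBl.
by rewrite Wa Wb Wm /D S1; split; field; rewrite s1 S0.
Qed.

Lemma s_convex2_le_chord (R : realType) (g : R -> R) (a b s x : R) :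
  s_convex2 s `[a, b] g -> x \in `]a, b[ ->
  g x <= ((b - x) / (b - a)) `^ s * g a + ((x - a) / (b - a)) `^ s * g b.
Proof.
move=> [_ _ conv]; rewrite in_itv/= => /andP[ax xb].
have ba : 0 < b - a by lra.
have aI : a \in `[a, b] by rewrite in_itv/= lexx/=; lra.
have bI : b \in `[a, b] by rewrite in_itv/= lexx andbT; lra.
have t0 : 0 <= (b - x) / (b - a) by rewrite divr_ge0//; lra.
have t1 : (b - x) / (b - a) <= 1 by rewrite ler_pdivrMr//; lra.
have := conv a b ((b - x) / (b - a)) aI bI t0 t1.
have -> : 1 - (b - x) / (b - a) = (x - a) / (b - a).
  by field; rewrite gt_eqF.
have -> // : (b - x) / (b - a) * a + (x - a) / (b - a) * b = x.
by field; rewrite gt_eqF.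
Qed.

(** * The inequality *)

Theorem theorem11 (R : realType) (f : R -> R) (a b s p q : R)
  (hf : forall x : R, 0 < x -> derivable f x 1)
  (ha : 0 < a) (hab : a < b)
  (hint : (@lebesgue_measure R).-integrable `[a, b] (EFin \o derive1 f))
  (hs0 : 0 < s) (hs1 : s <= 1)
  (hq : 1 < q) (hpq : p^-1 + q^-1 = 1)
  (hconv : s_convex2 s `[a, b] (fun x => `|derive1 f x| `^ q)) :
  `| (b - a)^-1 * \int[@lebesgue_measure R]_(x in `[a, b]) f x
     - 2^-1 * ((b * f a - a * f b) / (b - a) + f ((a + b) / 2)) |
  <= gen_log_mean p a b / (4 * (2 `^ s * (s + 1)) `^ q^-1)
     * ((`|derive1 f b| `^ q + (2 `^ (s + 1) - 1) * `|derive1 f a| `^ q) `^ q^-1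
        + (`|derive1 f a| `^ q + (2 `^ (s + 1) - 1) * `|derive1 f b| `^ q) `^ q^-1).
Proof.
set A := `|derive1 f a| `^ q; set B := `|derive1 f b| `^ q.
set L := gen_log_mean p a b; set D := 2 `^ s * (s + 1).
have q0 : 0 < q by lra.
have p0 : 0 < p.
  rewrite -invr_gt0 -(addrK q^-1 p^-1) hpq subr_gt0.
  by rewrite invf_lt1.
have ba : 0 < b - a by lra.
have c0 : 0 < (2 * (b - a))^-1 by rewrite invr_gt0 mulr_gt0.
have D0 : 0 < D by rewrite mulr_gt0 ?powR_gt0//; lra.
have Dq0 : D `^ q^-1 != 0 by rewrite gt_eqF// powR_gt0.
have ba0 : b - a != 0 by rewrite gt_eqF.
have alg (h M e x y : R) : h != 0 -> e != 0 ->
    (2 * h)^-1 * (h / 2 * (M / e * x) + h / 2 * (M / e * y)) =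
    M / (4 * e) * (x + y).
  by move=> h0 e0; field; rewrite h0 e0.
have cf x : 0 < x -> {for x, continuous f}.
  by move=> /hf hx; exact/differentiable_continuous/derivable1_diffP.
have fint : (@lebesgue_measure R).-integrable `[a, b] (EFin \o f).
  apply: continuous_compact_integrable; first exact: segment_compact.
  apply: derivable_within_continuous => x; rewrite in_itv/= => /andP[ax _].
  by apply: hf; lra.
pose Phi x := parameterized_integral (@lebesgue_measure R) a x f.
have cPhi : {within `[a, b], continuous Phi}.
  by apply: parameterized_integral_continuous => //; exact: ltW.
have hPhi (x : R) : x \in `]a, b[ -> is_derive x 1 Phi (f x).
  rewrite in_itv/= => /andP[ax xb].
  have [|dPhi PhiE] := continuous_FTC1_closed xb fint ax _; first by apply: cf; lra.
  by apply: (DeriveDef dPhi); rewrite -derive1E PhiE.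
have Phia : Phi a = 0.
  by rewrite /Phi /parameterized_integral set_itv1 Rintegral_set1.
have hle x : x \in `]a, b[ -> `|derive1 f x| `^ q <=
    ((b - x) / (b - a)) `^ s * A + ((x - a) / (b - a)) `^ s * B.
  exact: s_convex2_le_chord hconv.
rewrite -/(Phi b); set m := (a + b) / 2.
have [W1 W2] := sconvex_bound_primitive_half_increments A B hab hs0.
have am : m = a + (b - a) / 2 by rewrite /m; field.
have mb : b = m + (b - a) / 2 by rewrite /m; field.
have mleb : m <= b by rewrite /m; lra.
have alem : a <= m by rewrite /m; lra.
have A0 : 0 <= A by exact: powR_ge0.
have B0 : 0 <= B by exact: powR_ge0.
have S1 : 1 <= 2 `^ (s + 1) :> R.
  by rewrite -[leLHS](powRr0 2); apply: ler_powR; lra.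
(* The length factors of the two terms of the product recombine, since
   [p^-1 + q^-1 = 1]. *)
have bound (X Y w : R) : 0 <= X -> w = (b - a) / 2 * (X / D) ->
    Y <= ((b - a) / 2) `^ p^-1 * L * w `^ q^-1 ->
    Y <= (b - a) / 2 * (L / D `^ q^-1 * X `^ q^-1).
  move=> X0 -> H; apply: le_trans H _.
  rewrite le_eqVlt; apply/orP; left; apply/eqP.
  have h0 : 0 <= (b - a) / 2 by lra.
  have Di0 : 0 <= D^-1 by rewrite invr_ge0 ltW.
  rewrite (powRM _ h0 (mulr_ge0 X0 Di0)) (powRM _ X0 Di0).
  have -> : D^-1 `^ q^-1 = (D `^ q^-1)^-1.
    by rewrite -powR_inv1 ?(ltW D0)// -powRrM mulN1r powRN.
  set h := (b - a) / 2.
  have {3}-> : h = h `^ p^-1 * h `^ q^-1.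
    by rewrite -powRD ?hpq ?powRr1// oner_eq0.
  by ring.
have S10 : 0 <= 2 `^ (s + 1) - 1 :> R by rewrite subr_ge0.
have Xa0 := addr_ge0 B0 (mulr_ge0 S10 A0).
have Xb0 := addr_ge0 A0 (mulr_ge0 S10 B0).
have h1 := bound _ _ _ Xa0 W1 (half_kernel_increment_le ha hab hs0 p0 q0 hpq
  (lexx a) mleb am hf cPhi hPhi hle).
have h2 := bound _ _ _ Xb0 W2 (half_kernel_increment_le ha hab hs0 p0 q0 hpq
  alem (lexx b) mb hf cPhi hPhi hle).
rewrite Phia mulr0 addr0 in h1.
(* Here [Phi m] cancels, and the values of [f] at the midpoint combine to
   [- (b - a) * f m]. *)
have -> : (b - a)^-1 * Phi b - 2^-1 * ((b * f a - a * f b) / (b - a) + f m) =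
    (2 * (b - a))^-1 * ((a * f m + 2 * Phi m - b * f a) +
      (a * f b + 2 * Phi b - (b * f m + 2 * Phi m))).
  by field; rewrite gt_eqF.
rewrite normrM (gtr0_norm c0).
apply: le_trans (ler_wpM2l (ltW c0) (le_trans (ler_normD _ _) (lerD h1 h2))) _.
rewrite le_eqVlt; apply/orP; left; apply/eqP.
exact: alg.
Qed.
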